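(* Let $Q\in\mathbb{R}^{n\times n}$ be symmetric positive definite, $r\in\mathbb{R}^n$, $\Delta>0$, and let $W_r$, $\widetilde W_{r,\Delta}$, $M_Q$ and $M_\nu(n)$ be as in the context. Let $z,z'\in\{0,1\}^n$. If $$|W_r(z)-W_r(z')|>\Delta M_Q,$$ then $$\operatorname{sgn}\bigl(W_r(z)-W_r(z')\bigr)=\operatorname{sgn}\bigl(\widetilde W_{r,\Delta}(z)-\widetilde W_{r,\Delta}(z')\bigr).$$ Hence $z$ and $z'$ have the same strict order under $W_r$ and $\widetilde W_{r,\Delta}$. If $Q$ has half-bandwidth at most $\nu$ (where $0\le\nu\le n-1$), the condition $|W_r(z)-W_r(z')|>\Delta M_\nu(n)$ is also sufficient.
   Context: For $r\in\mathbb{R}^n$: $y_i=0$ if $r_i\ge0$ and $y_i=1$ otherwise; $s_i=1-2y_i$; $a=r-s$. Let $\alpha_i=2s_i(Qa)_i+2Q_{ii}$ and $\beta_{ij}=4s_is_jQ_{ij}$ for $i<j$. Let $\mathcal{E}_Q=\{\{i,j\}:1\le i<j\le n,\ Q_{ij}\ne0\}$ and $$W_r(z)=\sum_{i=1}^n\alpha_iz_i+\sum_{\{i,j\}\in\mathcal{E}_Q}\beta_{ij}z_iz_j.$$ Quantized coefficients: $\widetilde\alpha_i=\lfloor\alpha_i/\Delta\rceil$ and $\widetilde\beta_{ij}=\lfloor\beta_{ij}/\Delta\rceil$ for $\{i,j\}\in\mathcal{E}_Q$, where $\lfloor\cdot\rceil$ is rounding to a nearest integer with a fixed deterministic convention for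 half-integer ties. Define $$\widetilde W_{r,\Delta}(z)=\sum_i\widetilde\alpha_iz_i+\sum_{\{i,j\}\in\mathcal{E}_Q}\widetilde\beta_{ij}z_iz_j.$$ Also $M_Q=n+|\mathcal{E}_Q|$ and $M_\nu(n)=n(\nu+1)-\nu(\nu+1)/2$. $Q$ has half-bandwidth at most $\nu$ if $Q_{ij}=0$ whenever $|i-j|>\nu$. *)

(* Defs.v *)
From HB Require Import structures.
From mathcomp Require Import all_boot all_order all_algebra.
From mathcomp Require Import reals.

Set Implicit Arguments.
Unset Strict Implicit.
Unset Printing Implicit Defensive.

Import Order.TTheory GRing.Theory Num.Theory.
Local Open Scope ring_scope.

Definition symmetric_mx (R : realType) (n : nat) (Q : 'M[R]_n) : Prop :=
  Q^T = Q.

Definition posdef (R : realType) (n : nat) (Q : 'M[R]_n) : Prop :=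
  forall x : 'cV[R]_n, x != 0 -> 0 < (x^T *m Q *m x) 0 0.

(* Half-integer ties may be broken in either direction. *)
Definition nearest_rounding (R : realType) (rnd : R -> int) : Prop :=
  forall (x : R) (m : int), `|x - (rnd x)%:~R| <= `|x - m%:~R|.

Section Coefficients.
Variables (R : realType) (n : nat) (Q : 'M[R]_n) (r : 'cV[R]_n).

Definition yvec : 'cV[R]_n := \col_i (if 0 <= r i 0 then 0 else 1).

Definition svec : 'cV[R]_n := \col_i (1 - 2 * yvec i 0).

Definition avec : 'cV[R]_n := r - svec.

Definition alpha (i : 'I_n) : R :=
  2 * svec i 0 * (Q *m avec) i 0 + 2 * Q i i.

Definition beta (i j : 'I_n) : R := 4 * svec i 0 * svec j 0 * Q i j.

(* An unordered pair {i, j} is represented by (i, j) with i < j. *)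
Definition edges : {set 'I_n * 'I_n} :=
  [set p : 'I_n * 'I_n | (p.1 < p.2)%N && (Q p.1 p.2 != 0)].

Definition W (z : {ffun 'I_n -> bool}) : R :=
  \sum_i alpha i * (z i)%:R
  + \sum_(p in edges) beta p.1 p.2 * (z p.1)%:R * (z p.2)%:R.

Variables (rnd : R -> int) (Delta : R).

Definition alphaq (i : 'I_n) : int := rnd (alpha i / Delta).

Definition betaq (i j : 'I_n) : int := rnd (beta i j / Delta).

Definition Wq (z : {ffun 'I_n -> bool}) : int :=
  \sum_i alphaq i * (z i)%:R
  + \sum_(p in edges) betaq p.1 p.2 * (z p.1)%:R * (z p.2)%:R.

Definition MQ : nat := (n + #|edges|)%N.

Definition half_bandwidth_le (nu : nat) : Prop :=
  forall i j : 'I_n, (nu < `|i - j|)%N -> Q i j = 0.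

End Coefficients.

Definition Mnu (R : realType) (nu n : nat) : R :=
  n%:R * (nu%:R + 1) - nu%:R * (nu%:R + 1) / 2.

Definition same_strict_order (T : Type) (R S : realDomainType)
    (f : T -> R) (g : T -> S) (z z' : T) : Prop :=
  (f z < f z' /\ g z < g z') \/ (f z' < f z /\ g z' < g z).

(* Main.v *)
(** Rounding moves each of the [MQ Q] coefficients of [W] by at most [Delta / 2],
    and each binary monomial takes values in [{0, 1}], so the difference
    [W z - W z'] moves by at most [Delta * MQ Q / 2].  A difference exceeding
    [Delta * MQ Q] therefore keeps its sign.  In the banded case, vertex [j] is
    the larger endpoint of at most [min j nu] edges, which gives
    [MQ Q <= Mnu nu n]. *)
Require Import Defs.
From HB Require Import structures.
From mathcomp Require Import all_boot all_order all_algebra.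
From mathcomp Require Import reals.
From mathcomp Require Import zify ring lra.

Set Implicit Arguments.
Unset Strict Implicit.
Unset Printing Implicit Defensive.

Import Order.TTheory GRing.Theory Num.Theory.
Local Open Scope ring_scope.

(** Comparison with the two neighbours [rnd x - 1] and [rnd x + 1] is enough: at distance above 1/2,
    one of them would be strictly closer to [x]. *)
Lemma nearest_rounding_half (R : realType) (rnd : R -> int) (x : R) :
  nearest_rounding rnd -> `|x - (rnd x)%:~R| <= 1 / 2.
Proof.
move=> rndP.
have := rndP x (rnd x + 1); have := rndP x (rnd x - 1).
rewrite rmorphB rmorphD /=; set k := (rnd x)%:~R.
by do 3 case: ger0P => ?; lra.
Qed.

Lemma quantization_error (R : realType) (rnd : R -> int) (Delta c : R) :
  nearest_rounding rnd -> 0 < Delta ->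
  `|c - Delta * (rnd (c / Delta))%:~R| <= Delta / 2.
Proof.
move=> rndP Delta_gt0; have := nearest_rounding_half (c / Delta) rndP.
have -> : c - Delta * (rnd (c / Delta))%:~R
          = Delta * (c / Delta - (rnd (c / Delta))%:~R) by field; lra.
by rewrite normrM gtr0_norm //; move: Delta_gt0; nra.
Qed.

Lemma norm_sum_le_card (R : realType) (I : finType) (A : {pred I})
    (f : I -> R) (c : R) :
  (forall i, i \in A -> `|f i| <= c) -> `|\sum_(i in A) f i| <= c * #|A|%:R.
Proof.
move=> fc; rewrite mulr_natr -sumr_const.
by apply: le_trans (ler_norm_sum _ _ _) _; apply: ler_sum.
Qed.

(** The difference of two bits is -1, 0 or 1, so a coefficient is charged only once for the pair of
    points. *)
Lemma quantized_term_error (R : realType) (rnd : R -> int) (Delta c : R)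
    (b b' : bool) :
  nearest_rounding rnd -> 0 < Delta ->
  `|(c - Delta * (rnd (c / Delta))%:~R) * (b%:R - b'%:R)| <= Delta / 2.
Proof.
move=> rndP Delta_gt0; apply: le_trans (quantization_error c rndP Delta_gt0).
rewrite normrM ler_piMr //; case: b; case: b';
  by rewrite ?subrr ?subr0 ?sub0r ?normrN ?normr0 ?normr1.
Qed.

Section Quantization.
Variables (R : realType) (n : nat) (Q : 'M[R]_n) (r : 'cV[R]_n).
Variables (Delta : R) (rnd : R -> int).
Hypotheses (Delta_gt0 : 0 < Delta) (rndP : nearest_rounding rnd).
Implicit Types z : {ffun 'I_n -> bool}.

Lemma W_quantization_error z z' :
  `|(W Q r z - W Q r z')
    - Delta * (Wq Q r rnd Delta z - Wq Q r rnd Delta z')%:~R|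
  <= Delta / 2 * (MQ Q)%:R.
Proof.
pose err c : R := c - Delta * (rnd (c / Delta))%:~R.
(* The product of two bits is written as a conjunction, so that edge terms have the same shape as
   vertex terms and [quantized_term_error] covers both. *)
have errE u : W Q r u - Delta * (Wq Q r rnd Delta u)%:~R
  = \sum_i err (alpha Q r i) * (u i)%:R
    + \sum_(p in edges Q) err (beta Q r p.1 p.2) * (u p.1 && u p.2)%:R.
  rewrite /W /Wq rmorphD /= !rmorph_sum /= mulrDr !mulr_sumr opprD addrACA.
  rewrite -!sumrB; congr (_ + _); apply: eq_bigr => p _.
    by rewrite /err rmorphM /= /alphaq; case: (u p); rewrite /=; ring.
  rewrite /err !rmorphM /= /betaq.
  by case: (u p.1); case: (u p.2); rewrite /=; ring.
have -> : (W Q r z - W Q r z')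
    - Delta * (Wq Q r rnd Delta z - Wq Q r rnd Delta z')%:~R
  = \sum_i err (alpha Q r i) * ((z i)%:R - (z' i)%:R)
    + \sum_(p in edges Q) err (beta Q r p.1 p.2)
        * ((z p.1 && z p.2)%:R - (z' p.1 && z' p.2)%:R).
  transitivity ((W Q r z - Delta * (Wq Q r rnd Delta z)%:~R)
    - (W Q r z' - Delta * (Wq Q r rnd Delta z')%:~R)); first by rewrite rmorphB /=; ring.
  rewrite !errE opprD addrACA -!sumrB.
  by congr (_ + _); apply: eq_bigr => p _; rewrite mulrBr.
rewrite /MQ natrD mulrDr; apply: le_trans (ler_normD _ _) _; apply: lerD.
  rewrite -[X in _ <= _ * X%:R]card_ord; apply: norm_sum_le_card => i _.
  exact: quantized_term_error.
by apply: norm_sum_le_card => p _; exact: quantized_term_error.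
Qed.

Lemma quantized_order z z' :
  Delta * (MQ Q)%:R < `|W Q r z - W Q r z'| ->
  sgz (W Q r z - W Q r z') = sgz (Wq Q r rnd Delta z - Wq Q r rnd Delta z')
  /\ same_strict_order (W Q r) (Wq Q r rnd Delta) z z'.
Proof.
have := W_quantization_error z z'; rewrite /same_strict_order.
rewrite -[W Q r z < _]subr_lt0 -[W Q r z' < _]subr_gt0.
rewrite -[Wq Q r rnd Delta z < _]subr_lt0 -[Wq Q r rnd Delta z' < _]subr_gt0.
set D := W Q r z - _; set Dq := _ - Wq Q r rnd Delta z'.
(* If [D] is positive, [Delta * Dq] is at least [D - Delta * MQ / 2], hence above [Delta * MQ / 2],
   which is nonnegative; the negative case mirrors this. *)
have M_ge0 : 0 <= Delta * (MQ Q)%:R by rewrite mulr_ge0 // ltW.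
rewrite ler_norml => /andP[errl erru]; have [D_ge0|D_lt0] := ger0P D => DM.
  have D_gt0 : 0 < D by lra.
  have Dq_gt0 : 0 < Dq.
    by rewrite -(ltr0z R) -(pmulr_rgt0 _ Delta_gt0); lra.
  by split; [rewrite !gtr0_sgz | right].
have Dq_lt0 : Dq < 0.
  by rewrite -(ltrz0 R) -(pmulr_rlt0 _ Delta_gt0); lra.
by split; [rewrite !ltr0_sgz | left].
Qed.

End Quantization.

(** Doubling and moving the correction to the left avoid halving and truncated subtraction. The
    induction is on [n - nu]: each index from [nu] on contributes [nu], and the base case is a
    triangular sum. *)
Lemma sum_minn_double (nu n : nat) : (nu <= n)%N ->
  (2 * (\sum_(j < n) minn j nu) + nu * nu.+1 = 2 * (n * nu))%N.
Proof.
move/subnKC<-; elim: (n - nu)%N => [|k IHk]; last first.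
  rewrite addnS big_ord_recr /= (minn_idPr (leq_addr k nu)) mulSn.
  by move: IHk; move: (\sum_(_ < _) _)%N => s; lia.
rewrite addn0 (eq_bigr (fun j : 'I_nu => j : nat)); last first.
  by move=> j _; apply/minn_idPl/ltnW.
elim: nu => [|m IHm]; first by rewrite big_ord0.
by rewrite big_ord_recr /=; lia.
Qed.

Lemma card_ord_window (n a b : nat) :
  (#|[pred i : 'I_n | (a <= i < b)%N]| <= b - a)%N.
Proof.
rewrite cardE -(size_map val) -(size_iota a (b - a)); apply: uniq_leq_size.
  by rewrite (map_inj_uniq val_inj) enum_uniq.
by move=> _ /mapP[i + ->]; rewrite mem_enum inE mem_iota /=; lia.
Qed.

Lemma card_edges_band (R : realType) (n nu : nat) (Q : 'M[R]_n) :
  half_bandwidth_le Q nu -> (#|edges Q| <= \sum_(j < n) minn j nu)%N.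
Proof.
move=> band; rewrite -sum1_card (partition_big snd xpredT) //=.
apply: leq_sum => j _; rewrite sum1_card.
(* By truncated subtraction, the window of possible smaller endpoints starts at 0 when [j < nu]. *)
have -> : minn j nu = (j - (j - nu))%N by lia.
apply: leq_trans (card_ord_window n (j - nu) j).
(* With the larger endpoint fixed, an edge is determined by its smaller one. *)
rewrite -(card_in_image (f := fst)); last first.
  by move=> [i1 j1] [i2 j2] /andP[_ /eqP /= ->] /andP[_ /eqP /= ->] /= ->.
apply: subset_leq_card; apply/subsetP => _ /imageP[[i k] /andP[+ /eqP kj] ->].
rewrite /= in kj; subst k; rewrite !inE /= => /andP[ik Qik]; rewrite ik andbT leqNgt; apply: contraNN Qik => far.
by rewrite band //; lia.
Qed.

Lemma MQ_le_Mnu (R : realType) (n nu : nat) (Q : 'M[R]_n) :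
  (nu <= n)%N -> half_bandwidth_le Q nu -> (MQ Q)%:R <= Mnu R nu n.
Proof.
move=> nun /card_edges_band edges_le; have := sum_minn_double nun.
(* The [n] linear coefficients turn [2 * (n * nu)] into [2 * (n * nu.+1)], which gives twice [Mnu]
   after the cast to [R]. *)
move=> sumE; have {edges_le sumE} : (2 * MQ Q + nu * nu.+1 <= 2 * (n * nu.+1))%N.
  by rewrite /MQ; lia.
rewrite -(ler_nat R) natrD !natrM -natr1 /Mnu; lra.
Qed.

Theorem corollaryB2 (R : realType) (n : nat) (Q : 'M[R]_n) (r : 'cV[R]_n)
    (Delta : R) (rnd : R -> int)
    (Qsym : symmetric_mx Q) (Qpos : posdef Q) (Delta_gt0 : 0 < Delta)
    (rndP : nearest_rounding rnd) (z z' : {ffun 'I_n -> bool}) :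
  (Delta * (MQ Q)%:R < `|W Q r z - W Q r z'| ->
     sgz (W Q r z - W Q r z') = sgz (Wq Q r rnd Delta z - Wq Q r rnd Delta z')
     /\ same_strict_order (W Q r) (Wq Q r rnd Delta) z z')
  /\
  (forall nu : nat, (nu < n)%N -> half_bandwidth_le Q nu ->
     Delta * Mnu R nu n < `|W Q r z - W Q r z'| ->
     sgz (W Q r z - W Q r z') = sgz (Wq Q r rnd Delta z - Wq Q r rnd Delta z')
     /\ same_strict_order (W Q r) (Wq Q r rnd Delta) z z').
Proof.
split=> [|nu nu_lt_n band DM]; first exact: quantized_order.
apply: quantized_order => //; apply: le_lt_trans DM.
by rewrite ler_pM2l //; apply: MQ_le_Mnu => //; exact: ltnW.
Qed.
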